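(* Let $k$ be a field, let $G$ be an additive ordered abelian group and let $\mathcal{F}$ be a family of well-ordered subsets of $G$. Suppose that $k\neq \mathbb{F}_2$. Then the $k$-hull $k((\mathcal{F}))$ is a subgroup of $(\mathbb{K},+)$ if and only if $\mathcal{F}$ satisfies all of the following conditions: (S2) $A\in\mathcal{F}$ and $B\subseteq A$ implies $B\in\mathcal{F}$; (S3) $A,B\in\mathcal{F}$ implies $A\cup B\in\mathcal{F}$; (S5) $\mathcal{F}\neq\emptyset$.
   Context: Ordered abelian groups are totally ordered. $\mathbb{K}=k((G))$ denotes the field of generalised power series with coefficient field $k$ and value group $G$: the set of all functions $s\colon G\to k$ whose support $\mathrm{supp}(s)=\{g\in G\mid s(g)\neq 0\}$ is a well-ordered subset of $G$, with pointwise addition and product $(rs)(g)=\sum_{h\in G}r(h)s(g-h)$. The $k$-hull of $\mathcal{F}$ in $\mathbb{K}$ is the set $k((\mathcal{F}))=\{a\in\mathbb{K}\mid \mathrm{supp}(a)\in\mathcal{F}\}$. $\mathbb{F}_2$ is the field with two elements. *)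

(* Defs.v *)
From HB Require Import structures.
From mathcomp Require Import all_boot all_order all_algebra.
From mathcomp Require Import boolp classical_sets functions wochoice.

Set Implicit Arguments.
Unset Strict Implicit.
Unset Printing Implicit Defensive.

Import Order.TTheory GRing.Theory Num.Theory.
Local Open Scope classical_set_scope.
Local Open Scope ring_scope.

(* The totality axiom is part of the mixin because a structure joining
   [Order.Total] with [GRing.Zmodule] would have to be declared before
   [Num.RealDomain]. *)
HB.mixin Record POrderedZmodule_isOrdered G of Num.POrderedZmodule G := {
  oz_le_total : total (<=%R : rel G);
  oz_lerD2r : forall z x y : G, x <= y -> x + z <= y + z
}.

#[short(type="orderedZmodType")]
HB.structure Definition OrderedZmodule := {
  G of Num.POrderedZmodule G & POrderedZmodule_isOrdered G
}.

Section WellOrdered.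
Variable G : orderedZmodType.
Implicit Types A B : set G.

Definition well_ordered A : Prop := wo_chain (<=%R : rel G) (mem A).

Lemma well_orderedP A :
  well_ordered A <->
  forall B, B `<=` A -> B !=set0 -> exists2 m, B m & lbound B m.
Proof.
split=> [woA B BA [x Bx] | minA].
  have [|| m [[mB lbm] _]] := woA (mem B).
  - by move=> y; rewrite inE => /BA ?; apply/mem_set.
  - by exists x; apply/mem_set.
  by exists m => [|y By]; [exact/set_mem | apply/lbm/mem_set].
apply: antisymmetric_wo_chain => [x y _ _|B BA [x Bx]]; first exact: le_anti.
have [|| m mB lbm] := minA [set` B].
- by move=> y /BA /set_mem.
- by exists x.
by exists m; split.
Qed.

Lemma well_ordered0 : well_ordered set0.
Proof. by apply/well_orderedP => B B0 [x /B0]. Qed.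

Lemma well_orderedS A B : A `<=` B -> well_ordered B -> well_ordered A.
Proof.
move=> AB /well_orderedP woB; apply/well_orderedP => C CA.
exact/woB/(subset_trans CA AB).
Qed.

Lemma well_orderedU A B :
  well_ordered A -> well_ordered B -> well_ordered (A `|` B).
Proof.
move=> /well_orderedP woA /well_orderedP woB; apply/well_orderedP => C CAB C0.
have [CA0|CA0] := pselect (C `&` A !=set0); last first.
  apply: woB => // x Cx; have [Ax|//] := CAB _ Cx.
  by case: CA0; exists x.
have [CB0|CB0] := pselect (C `&` B !=set0); last first.
  apply: woA => // x Cx; have [//|Bx] := CAB _ Cx.
  by case: CB0; exists x.
have [a [Ca _] lba] := woA _ (@subIsetr _ C A) CA0.
have [b [Cb _] lbb] := woB _ (@subIsetr _ C B) CB0.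
have /orP[ab|ba] := oz_le_total a b.
  exists a => // x Cx; have [Ax|Bx] := CAB _ Cx; first exact: lba.
  by apply: le_trans ab _; apply: lbb.
exists b => // x Cx; have [Ax|Bx] := CAB _ Cx; last exact: lbb.
by apply: le_trans ba _; apply: lba.
Qed.

End WellOrdered.

Section HahnSeries.
Variables (k : fieldType) (G : orderedZmodType).

Definition supp (s : G -> k) : set G := [set g | s g != 0].

Definition hahn_pred : {pred G -> k} := [pred s | `[< well_ordered (supp s) >]].

Lemma hahn_pred_zmod_closed : zmod_closed hahn_pred.
Proof.
split=> [|r s /asboolP wor /asboolP wos]; apply/asboolP.
  by apply: well_orderedS (@well_ordered0 G) => g; rewrite /supp /= eqxx.
apply: well_orderedS (well_orderedU wor wos) => g /= rs_neq0.
have [r0|] := eqVneq (r g) 0; last by left.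
right; apply: contraNneq rs_neq0 => s0.
by rewrite [X in X == 0](_ : _ = r g - s g) // r0 s0 subr0.
Qed.

HB.instance Definition _ :=
  GRing.isZmodClosed.Build (G -> k) hahn_pred hahn_pred_zmod_closed.

(* The additive structure is inherited from the pointwise one on [G -> k]. *)
Record hahn_series := HahnSeries {
  hahn_val :> G -> k;
  hahn_valP : hahn_val \in hahn_pred
}.

HB.instance Definition _ := [isSub for hahn_val].
HB.instance Definition _ := [Choice of hahn_series by <:].
HB.instance Definition _ := [SubChoice_isSubZmodule of hahn_series by <:].

Definition khull (F : set (set G)) : set hahn_series :=
  [set a | F (supp a)].

End HahnSeries.

Arguments khull k {G} F.
Arguments hahn_pred : clear implicits.

(* Main.v *)
Require Import Defs.
From mathcomp Require Import all_boot all_order all_algebra.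
From mathcomp Require Import boolp classical_sets functions.
From HB Require Import structures.

(** The support of a difference always lies in the union of the two supports,
    so (S2), (S3) and (S5) make the hull a subgroup.

    For the converse, well-orderedness of the members of F means that every
    function with support in F is a series, so the subgroup property says that
    the supports in F are stable under differences of functions.  A field other
    than F_2 has a scalar c outside {0, 1} ([third_scalar]).  For B contained in
    A, the function with value 1 on A minus the function with value c on B and
    1 on A \ B has support exactly B, although both terms have support A; this
    is (S2).  Over F_2 a series is determined by its support and the subtraction
    would produce only symmetric differences.  Once (S2) is known, B may be
    replaced by B \ A in (S3), and then no cancellation can occur: the
    difference of the indicators of A and B \ A has support A `|` B. *)

Set Implicit Arguments.
Unset Strict Implicit.
Unset Printing Implicit Defensive.

Import Order.TTheory GRing.Theory Num.Theory.
Local Open Scope classical_set_scope.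
Local Open Scope ring_scope.

(** In a field with elements 0 and 1 only, 1 + 1 = 1 is impossible, hence
    1 + 1 = 0 and sending nonzero elements to 1 respects both operations. *)
Lemma two_element_field_iso_F2 (k : fieldType) :
  (forall x : k, x = 0 \/ x = 1) ->
  exists f : {rmorphism k -> 'F_2}, bijective f.
Proof.
move=> k01; pose f (x : k) : 'F_2 := (x != 0)%:R.
have f0 : f 0 = 0 by rewrite /f eqxx.
have f1 : f 1 = 1 by rewrite /f oner_eq0.
have two0 : 1 + 1 = 0 :> k.
  by have [//|/eqP] := k01 (1 + 1); rewrite -subr_eq0 addrK oner_eq0.
have opp1 : - 1 = 1 :> k by apply/esym/eqP; rewrite -addr_eq0 two0.
have fB : zmod_morphism f.
  move=> x y; have [->|->] := k01 x; have [->|->] := k01 y;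
    by rewrite ?subr0 ?sub0r ?subrr ?opp1 ?f0 ?f1 //; apply/val_inj.
have fM : monoid_morphism f.
  split=> // x y; have [->|->] := k01 x; have [->|->] := k01 y;
    by rewrite ?mul0r ?mul1r ?f0 ?f1 ?mul0r ?mul1r.
pose fA := GRing.isZmodMorphism.Build _ _ f fB.
pose fMm := GRing.isMonoidMorphism.Build _ _ f fM.
pose F : {rmorphism k -> 'F_2} := HB.pack f fA fMm.
exists F; exists (fun y : 'F_2 => (y != 0)%:R : k) => [x|y].
  by rewrite /=; have [->|->] := k01 x; rewrite ?f0 ?f1.
by case: y => [[|[|//]] yP]; apply/val_inj; rewrite /= /f /= ?eqxx ?oner_eq0.
Qed.

Lemma third_scalar (k : fieldType) :
  (~ exists f : {rmorphism k -> 'F_2}, bijective f) ->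
  exists c : k, c != 0 /\ c != 1.
Proof.
move=> knF2; apply: contrapT => no_c; apply/knF2/two_element_field_iso_F2 => x.
have [->|x0] := eqVneq x 0; first by left.
by have [->|x1] := eqVneq x 1; [right | case: no_c; exists x].
Qed.

Section Hull.
Context {k : fieldType} {G : orderedZmodType}.

(** Members of F are well-ordered, so s and t are automatically series; the
    witnesses below can therefore be bare functions. *)
Lemma khull_closed_supp_sub (F : set (set G)) (s t : G -> k) :
  (forall A : set G, F A -> well_ordered A) -> zmod_closed (mem (khull k F)) ->
  F (supp s) -> F (supp t) -> F (supp (fun g => s g - t g)).
Proof.
move=> F_wo [_ FB] Fs Ft.
pose a := HahnSeries (asboolT (F_wo _ Fs) : s \in hahn_pred k G).
pose b := HahnSeries (asboolT (F_wo _ Ft) : t \in hahn_pred k G).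
have /set_mem : a - b \in khull k F by apply: FB; apply/mem_set.
by [].
Qed.

Lemma supp_sub (s t : G -> k) :
  supp (fun g => s g - t g) `<=` supp s `|` supp t.
Proof.
move=> g /=; have [s0|] := eqVneq (s g) 0; last by left.
by have [t0|] := eqVneq (t g) 0; [rewrite /supp /= s0 t0 subr0 eqxx | right].
Qed.

(** Over a field with a third scalar, the part of the support outside B can be
    cancelled while both terms keep the support A. *)
Lemma supp_sub_cancel (c : k) (A B : set G) : c != 0 -> c != 1 -> B `<=` A ->
  exists s t : G -> k, [/\ supp s = A, supp t = A
    & supp (fun g => s g - t g) = B].
Proof.
move=> c0 c1 BA; pose s g : k := (g \in A)%:R.
pose t g : k := if g \in B then c else s g.
have sA : supp s = A.
  apply/seteqP; split=> g; rewrite /supp /s /=.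
    by case: (boolP (g \in A)) => [/set_mem|]; rewrite ?eqxx.
  by move=> /mem_set ->; rewrite oner_eq0.
exists s, t; split=> //.
  rewrite -[RHS]sA; apply/seteqP; split=> g; rewrite /supp /t /=;
    case: (boolP (g \in B)) => [/set_mem/BA/mem_set gA|//] _ //.
  by rewrite /s gA oner_eq0.
apply/seteqP; split=> g; rewrite /supp /t /=.
  by case: (boolP (g \in B)) => [/set_mem|]; rewrite ?subrr ?eqxx.
move=> Bg; rewrite /s (mem_set Bg) (mem_set (BA _ Bg)).
by rewrite subr_eq0 eq_sym.
Qed.

(** Removing A from B makes the two indicators disjoint, so that nothing
    cancels whatever the characteristic. *)
Lemma supp_sub_union (A B : set G) :
  exists s t : G -> k, [/\ supp s = A, supp t = B `\` A
    & supp (fun g => s g - t g) = A `|` B].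
Proof.
pose i (X : set G) g : k := (g \in X)%:R.
have iE X : supp (i X) = X.
  apply/seteqP; split=> g; rewrite /supp /i /=.
    by case: (boolP (g \in X)) => [/set_mem|]; rewrite ?eqxx.
  by move=> /mem_set ->; rewrite oner_eq0.
exists (i A), (i (B `\` A)); split=> //; apply/seteqP; split=> g.
  by move=> /supp_sub; rewrite !iE => -[|[]]; [left | right].
rewrite /supp /i /=; have [Ag _|nAg [//|Bg]] := pselect (A g).
  by rewrite mem_set // memNset ?subr0 ?oner_eq0 // => -[].
rewrite (memNset nAg) (mem_set (conj Bg nAg : (B `\` A) g)).
by rewrite sub0r oppr_eq0 oner_eq0.
Qed.

End Hull.

Theorem proposition3p4 (k : fieldType) (G : orderedZmodType)
    (F : set (set G))
    (F_wo : forall A : set G, F A -> well_ordered A)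
    (k_neq_F2 : ~ exists f : {rmorphism k -> 'F_2}, bijective f) :
  zmod_closed (mem (khull k F)) <->
  [/\ (* (S2) *) forall A B : set G, F A -> B `<=` A -> F B,
      (* (S3) *) forall A B : set G, F A -> F B -> F (A `|` B)
    & (* (S5) *) F !=set0].
Proof.
split=> [Fsub | [S2 S3 [A FA]]].
  have [c [c0 c1]] := third_scalar k_neq_F2.
  have S2 A B : F A -> B `<=` A -> F B.
    move=> FA BA; have [s [t [sA tA <-]]] := supp_sub_cancel c0 c1 BA.
    by apply: khull_closed_supp_sub => //; rewrite ?sA ?tA.
  split=> // [A B FA FB|].
    have [s [t [sA tBA <-]]] := @supp_sub_union k _ A B.
    apply: khull_closed_supp_sub => //; rewrite ?sA ?tBA //.
    exact: S2 FB (@subDsetl _ _ _).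
  by case: Fsub => /set_mem F0 _; exists (supp (0 : hahn_series k G)).
split=> [|a b /set_mem Fa /set_mem Fb]; apply/mem_set.
  by apply: S2 FA _ => g; rewrite /supp /= eqxx.
exact: S2 (S3 _ _ Fa Fb) (@supp_sub _ _ a b).
Qed.
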